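(* Let $\mathbf{x}_*$ be a solution of $\mathbf{x}=\mathbf{a}+\mathscr{B}\mathbf{x}^2$ with $R_{\mathbf{x}_*}$ invertible, and let $\tilde{\mathbf{x}}_k$ be the sequence computed by Newton's method for this equation in machine arithmetic with precision $\mathsf{u}$. Define: (a) $\mathbf{e}_k$, the error incurred in the computation of the residual $\tilde{\mathbf{r}}_k$; (b) $E_k$, the error incurred when computing the Jacobian $R_{\tilde{\mathbf{x}}_k}$ and solving the linear system $R_{\tilde{\mathbf{x}}_k}^{-1}(\mathbf{r}_k+\mathbf{e}_k)$, counted as a backward error for the linear system, so that the increment computed in machine arithmetic is $\tilde{\mathbf{h}}_k=(R_{\tilde{\mathbf{x}}_k}+E_k)^{-1}(\mathbf{r}_k+\mathbf{e}_k)$; (c) $\boldsymbol{\varepsilon}_k$, the error incurred in the subtraction $\tilde{\mathbf{x}}_k-\tilde{\mathbf{h}}_k$. Suppose that $$\|R_{\tilde{\mathbf{x}}_k}^{-1}E_k\|\le\nu<1,\qquad \beta\,\|R_{\mathbf{x}_*}^{-1}\|\,\|\tilde{\mathbf{x}}_k-\mathbf{x}_*\|\le\mu<1,$$ where $\beta$ is a Lipschitz constant for $R_{\mathbf{x}}$. (One can take $\beta=\frac{\|\mathscr{B}\|}{2}$ in this problem.) Then $$\|\tilde{\mathbf{x}}_{k+1}-\mathbf{x}_*\|\le G_k\|\tilde{\mathbf{x}}_k-\mathbf{x}_*\|+\mathbf{g}_k,$$ with $$G_k=\frac{\nu}{1-\nu}+\frac{\mu}{2(1-\mu)(1-\nu)}+\mathsf{u},\qquad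 \mathbf{g}_k=\frac{1}{1-\nu}\,\frac{1}{1-\mu}\,\|R_{\mathbf{x}_*}^{-1}\mathbf{e}_k\|+\mathsf{u}\left(\|\mathbf{x}_*\|+\|\tilde{\mathbf{h}}_k\|\right).$$
   Context: $\mathbf{a}\in\mathbb{R}^n$ is a nonnegative vector and $\mathscr{B}=(b_{ijk})$ a nonnegative $n\times n\times n$ tensor; $(\mathscr{B}\mathbf{x}^2)_i=\sum_{j,k}b_{ijk}x_jx_k$. The matrix $R_{\mathbf{x}}$ has entries $(R_{\mathbf{x}})_{ij}=\delta_{ij}-\sum_k(b_{ikj}+b_{ijk})x_k$; it is the Jacobian of $\mathbf{x}\mapsto\mathbf{x}-\mathbf{a}-\mathscr{B}\mathbf{x}^2$. Newton's method in exact arithmetic is $\mathbf{x}_{k+1}=\mathbf{x}_k-R_{\mathbf{x}_k}^{-1}(\mathbf{x}_k-\mathbf{a}-\mathscr{B}\mathbf{x}_k^2)$. Here $\mathbf{r}_k=\tilde{\mathbf{x}}_k-\mathbf{a}-\mathscr{B}\tilde{\mathbf{x}}_k^2$ is the exact residual at $\tilde{\mathbf{x}}_k$, $\tilde{\mathbf{r}}_k=\mathbf{r}_k+\mathbf{e}_k$ is the residual computed in machine arithmetic, and the computed next iterate is $\tilde{\mathbf{x}}_{k+1}=\tilde{\mathbf{x}}_k-\tilde{\mathbf{h}}_k+\boldsymbol{\varepsilon}_k$. Machine arithmetic with precision $\mathsf{u}$ means standard floating-point arithmetic with unit roundoff $\mathsf{u}$. $\|\cdot\|$ denotes a vector norm,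 the induced matrix norm, and the corresponding norm of a tensor. $\beta$ being a Lipschitz constant for $R_{\mathbf{x}}$ means $\|R_{\mathbf{x}}-R_{\mathbf{y}}\|\le\beta\|\mathbf{x}-\mathbf{y}\|$.
   Formalization: The vector norm is assumed monotone (|x_i| ≤ |y_i| for all i implies ‖x‖ ≤ ‖y‖), since entrywise rounding breaks the bound otherwise; the remark that one can take β = ‖B‖/2 is dropped because it is false (n = 1 needs 2b), β being any Lipschitz constant. *)

(* Defs.v *)
From mathcomp Require Import all_boot all_order all_algebra.
From mathcomp Require Import all_classical reals.

Set Implicit Arguments.
Unset Strict Implicit.
Unset Printing Implicit Defensive.

Import Order.TTheory GRing.Theory Num.Theory.

Local Open Scope classical_set_scope.
Local Open Scope ring_scope.

Record vector_norm (R : realType) (n : nat) (N : 'cV[R]_n -> R) : Prop :=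
  VectorNorm {
    vector_norm_eq0 : forall x, N x = 0 -> x = 0;
    vector_normZ : forall c x, N (c *: x) = `|c| * N x;
    vector_normD : forall x y, N (x + y) <= N x + N y }.

(* Monotone (equivalently, absolute) norms, e.g. all p-norms: those in which
   entrywise rounding errors `|delta_i| <= u may be measured normwise, i.e.
   N (\col_i (delta_i * x_i)) <= u * N x.  A general norm does not satisfy it. *)
Definition monotone_norm (R : realType) (n : nat) (N : 'cV[R]_n -> R) : Prop :=
  forall x y : 'cV[R]_n, (forall i, `|x i 0| <= `|y i 0|) -> N x <= N y.

(* The supremum is that of a nonempty set, bounded since the dimension is
   finite, so the value of [sup] on unbounded sets plays no role. *)
Definition induced_norm (R : realType) (n : nat) (N : 'cV[R]_n -> R)
    (A : 'M[R]_n) : R :=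
  sup [set N (A *m v) | v in [set v | N v <= 1]].

Section QuadraticVectorEquation.
Variables (R : realType) (n : nat).
Variables (a : 'cV[R]_n) (B : 'I_n -> 'I_n -> 'I_n -> R).
Implicit Types x y : 'cV[R]_n.

Definition tensor_sq x : 'cV[R]_n :=
  \col_i \sum_j \sum_k B i j k * x j 0 * x k 0.

Definition residual x : 'cV[R]_n := x - a - tensor_sq x.

Definition jacobian x : 'M[R]_n :=
  \matrix_(i, j) ((i == j)%:R - \sum_k (B i k j + B i j k) * x k 0).

Definition jacobian_lipschitz (N : 'cV[R]_n -> R) (beta : R) : Prop :=
  forall x y, induced_norm N (jacobian x - jacobian y) <= beta * N (x - y).

(* Newton's method in floating-point arithmetic with unit roundoff [u], with
   iterates [xt k], computed residuals [rt k] and computed increments [h k].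
   The errors [e k] (residual), [E k] (Jacobian and linear solve, as a backward
   error) and [eps k] (final subtraction) are defined by the equations below.
   [newton_fl_sub] is the standard model fl(s - t) = (s - t)(1 + delta),
   `|delta| <= u, for the entries of the subtraction [xt k - h k]; no particular
   algorithm is prescribed for the residual and for the linear system. *)
Record machine_newton (u : R) (xt rt h : nat -> 'cV[R]_n)
    (e : nat -> 'cV[R]_n) (E : nat -> 'M[R]_n) (eps : nat -> 'cV[R]_n) : Prop :=
  MachineNewton {
    newton_residual : forall k, rt k = residual (xt k) + e k;
    newton_increment : forall k,
      h k = invmx (jacobian (xt k) + E k) *m (residual (xt k) + e k);
    newton_update : forall k, xt k.+1 = xt k - h k + eps k;
    newton_fl_sub : forall k i, exists2 delta : R, `|delta| <= u &
      xt k.+1 i 0 = (xt k i 0 - h k i 0) * (1 + delta) }.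

End QuadraticVectorEquation.

(* Main.v *)
Require Import Defs.
From mathcomp Require Import all_boot all_order all_algebra.
From mathcomp Require Import all_classical reals.
From mathcomp Require Import ring lra.

Set Implicit Arguments.
Unset Strict Implicit.
Unset Printing Implicit Defensive.

Import Order.TTheory GRing.Theory Num.Theory.

Local Open Scope ring_scope.

(** Write [J] and [Js] for the Jacobians at the current iterate [x] and at the
solution [xs], [F] for the residual map, [d = x - xs] and [r = F x].  Since [F]
is quadratic and [F xs = 0], the secant identity
[r = 2^-1 *: ((J + Js) *m d)] ([residualB]) is exact, so that
[r = J d + (Js - J) d / 2].  The error of the computed Newton step before the
final subtraction is [y = d - (J + E)^-1 (r + e)], hence
[[
   (J + E) y = E d - ((Js - J) d / 2 + e).
]]
Put [T2 = J^-1 E] and [T1 = Js^-1 (J - Js)].  Multiplying by [J^-1] gives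
[(1 + T2) y = T2 d - z], where [z = J^-1 ((Js - J) d / 2 + e)], and rewriting
[J = Js (1 + T1)] gives [(1 + T1) z = Js^-1 e - T1 d / 2].
The hypotheses say that [T2] contracts by [nu] and, through the Lipschitz bound,
that [T1] contracts by [mu].  A perturbation [1 + T] of the identity by a
[c]-contraction is invertible and multiplies no norm by a factor smaller than [1 - c]
([unitmx_contraction], [contraction_lower_bound]), so
[[
   (1 - mu) N z <= mu / 2 * N d + N (Js^-1 e),  (1 - nu) N y <= nu N d + N z,
]]
which together bound [N y].  The final subtraction adds at most
[u * N (x - h) <= u * (N d + N xs + N h)], because the norm is monotone
([rounding_error_le]).

Induced norms enter only through [N (A *m v) <= induced_norm N A * N v]
([induced_normP]), which holds because the supremum defining them is finite
([mulmx_norm_bound]). *)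

(** * Norms on column vectors and the induced matrix norm *)

Section VectorNorm.
Variables (R : realType) (n : nat) (N : 'cV[R]_n -> R).
Hypothesis N_norm : vector_norm N.
Implicit Types (A T : 'M[R]_n) (v x y : 'cV[R]_n).

Lemma vector_norm0 : N 0 = 0.
Proof. by rewrite -(scale0r 0) (vector_normZ N_norm) normr0 mul0r. Qed.

Lemma vector_normN x : N (- x) = N x.
Proof. by rewrite -scaleN1r (vector_normZ N_norm) normrN1 mul1r. Qed.

Lemma vector_norm_ge0 x : 0 <= N x.
Proof.
have := vector_normD N_norm x (- x).
by rewrite subrr vector_norm0 vector_normN; lra.
Qed.

Lemma vector_normB x y : N (x - y) <= N x + N y.
Proof. by rewrite -(vector_normN y); apply: (vector_normD N_norm). Qed.

Lemma vector_norm_sum (I : finType) (F : I -> 'cV[R]_n) :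
  N (\sum_i F i) <= \sum_i N (F i).
Proof.
elim/big_ind2: _ => [|x a y b xa yb|//]; first by rewrite vector_norm0.
exact: le_trans (vector_normD N_norm _ _) (lerD xa yb).
Qed.

Lemma col_delta_sum v : v = \sum_j v j 0 *: delta_mx j 0.
Proof.
by rewrite {1}[v]matrix_sum_delta; apply: eq_bigr => j _; rewrite big_ord1.
Qed.

Lemma vector_norm_delta_gt0 j : 0 < N (delta_mx j 0).
Proof.
rewrite lt_neqAle vector_norm_ge0 andbT eq_sym; apply/eqP => /(vector_norm_eq0 N_norm).
move/matrixP/(_ j 0); rewrite !mxE !eqxx => /eqP.
by rewrite oner_eq0.
Qed.

(** * Perturbations of the identity *)

(** Reverse triangle inequality for [v = (1 + T) v - T v]. *)
Lemma contraction_lower_bound T c :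
  (forall v, N (T *m v) <= c * N v) ->
  forall v, (1 - c) * N v <= N ((1%:M + T) *m v).
Proof.
move=> Tc v; have := vector_normB ((1%:M + T) *m v) (T *m v).
by rewrite mulmxDl mul1mx addrK; have := Tc v; lra.
Qed.

(** The lower bound makes the kernel of [1 + T] trivial. *)
Lemma unitmx_contraction T c :
  c < 1 -> (forall v, N (T *m v) <= c * N v) -> 1%:M + T \in unitmx.
Proof.
move=> c1 Tc; rewrite -unitmx_tr -row_free_unit; apply: inj_row_free => v.
move/(congr1 trmx); rewrite trmx_mul trmxK trmx0 => Tv0.
have := contraction_lower_bound Tc v^T; rewrite Tv0 vector_norm0 => Nv.
apply: trmx_inj; rewrite trmx0; apply: (vector_norm_eq0 N_norm).
apply/le_anti/andP; split; last exact: vector_norm_ge0.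
by rewrite -(pmulr_rle0 _ (_ : 0 < 1 - c)) // subr_gt0.
Qed.

(** * Bounds for monotone norms *)

Hypothesis N_mono : monotone_norm N.

(** Monotonicity bounds each coordinate directly,
[`|v j| * N e_j = N (v j *: e_j) <= N v], so that [A *m v], a combination of the
columns [A *m e_j] with coefficients [v j], stays bounded on the unit ball. *)
Lemma mulmx_norm_bound A v :
  N (A *m v) <= (\sum_j N (A *m delta_mx j 0) / N (delta_mx j 0)) * N v.
Proof.
rewrite {1}[v]col_delta_sum mulmx_sumr mulr_suml.
apply: (le_trans (vector_norm_sum _)); apply: ler_sum => j _.
rewrite -scalemxAr (vector_normZ N_norm) mulrC -mulrA.
apply: ler_wpM2l; first exact: vector_norm_ge0.
rewrite mulrC ler_pdivlMr ?vector_norm_delta_gt0 //.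
rewrite -(vector_normZ N_norm); apply: N_mono => i; rewrite !mxE andbT.
by case: eqP => [->|_]; rewrite ?mulr1 // mulr0 normr0.
Qed.

Lemma induced_norm_has_sup A :
  has_sup [set N (A *m v) | v in [set v | N v <= 1]]%classic.
Proof.
split; first by exists (N (A *m 0)), 0 => //=; rewrite vector_norm0.
exists (\sum_j N (A *m delta_mx j 0) / N (delta_mx j 0)) => _ [v /= v1 <-].
apply: (le_trans (mulmx_norm_bound A v)); apply: ler_piMr => //.
by apply: sumr_ge0 => j _; rewrite divr_ge0 ?vector_norm_ge0.
Qed.

Lemma induced_norm_ge0 A : 0 <= induced_norm N A.
Proof.
apply: ub_le_sup; first by case: (induced_norm_has_sup A).
by exists 0; rewrite /= ?mulmx0 vector_norm0.
Qed.

Lemma induced_normP A v : N (A *m v) <= induced_norm N A * N v.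
Proof.
have [Nv0|Nv_neq0] := eqVneq (N v) 0.
  by rewrite (vector_norm_eq0 N_norm Nv0) mulmx0 vector_norm0 mulr0.
have Nv_gt0 : 0 < N v by rewrite lt_neqAle eq_sym Nv_neq0 vector_norm_ge0.
have Nv1_ge0 : 0 <= (N v)^-1 by rewrite invr_ge0 ltW.
rewrite -ler_pdivrMr //; apply: ub_le_sup.
  by case: (induced_norm_has_sup A).
exists ((N v)^-1 *: v) => /=.
  by rewrite (vector_normZ N_norm) ger0_norm // mulVf.
by rewrite -scalemxAr (vector_normZ N_norm) ger0_norm // mulrC.
Qed.

(** The entries of [y - x] are [x i 0 * delta], dominated by those of [u *: x];
monotonicity turns this into a normwise bound. *)
Lemma rounding_error_le (u : R) x y : 0 <= u ->
  (forall i, exists2 delta : R, `|delta| <= u & y i 0 = x i 0 * (1 + delta)) ->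
  N (y - x) <= u * N x.
Proof.
move=> u0 fl; rewrite -[u in u * _]ger0_norm // -(vector_normZ N_norm).
apply: N_mono => i; rewrite !mxE; have [delta delta_le ->] := fl i.
rewrite mulrDr mulr1 addrAC subrr add0r mulrC !normrM (ger0_norm u0).
exact: ler_wpM2r.
Qed.

End VectorNorm.

(** * The residual map and its Jacobian *)

Section Jacobian.
Variables (R : realType) (n : nat) (B : 'I_n -> 'I_n -> 'I_n -> R).
Implicit Types a v x y : 'cV[R]_n.

(** Exchanging the two summation indices in one of the two terms of the
Jacobian turns its action into the polarization of the tensor square. *)
Lemma jacobian_mulmxE x v i :
  (jacobian B x *m v) i 0 =
  v i 0 - \sum_j \sum_k B i j k * (x j 0 * v k 0 + v j 0 * x k 0).
Proof.
rewrite mxE; under eq_bigr do rewrite mxE mulrBl.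
rewrite sumrB; congr (_ - _).
  rewrite (bigD1 i) //= eqxx mul1r big1 ?addr0 // => j ji.
  by rewrite eq_sym (negbTE ji) mul0r.
under eq_bigr do (rewrite mulr_suml; under eq_bigr do rewrite !mulrDl).
under [RHS]eq_bigr do (under eq_bigr do rewrite mulrDr; rewrite big_split /=).
under eq_bigr do rewrite big_split /=.
rewrite !big_split /= exchange_big /=.
by congr (_ + _); do 2![apply: eq_bigr => ? _]; ring.
Qed.

(** A quadratic map has no remainder beyond the trapezoidal rule: its increment
is given by the mean of the Jacobians at the two end points. *)
Lemma residualB a x y :
  residual a B x - residual a B y =
  2^-1 *: ((jacobian B x + jacobian B y) *m (x - y)).
Proof.
apply/colP => i; rewrite mulmxDl [RHS]mxE [in RHS]mxE !jacobian_mulmxE.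
rewrite !mxE /=.
set Sx := \sum_j \sum_k B i j k * x j 0 * x k 0.
set Sy := \sum_j \sum_k B i j k * y j 0 * y k 0.
set S1 := \sum_j _; set S2 := \sum_j _.
have -> : S2 = 2 * (Sx - Sy) - S1; last by field.
apply/eqP; rewrite eq_sym subr_eq; apply/eqP.
rewrite /S1 /S2 /Sx /Sy -sumrB mulr_sumr -big_split; apply: eq_bigr => j _.
rewrite -sumrB mulr_sumr -big_split; apply: eq_bigr => k _ /=.
by rewrite !mxE; ring.
Qed.

End Jacobian.

(** * One step of the inexact Newton iteration *)

Section NewtonStep.
Variables (R : realType) (n : nat) (N : 'cV[R]_n -> R).
Hypothesis N_norm : vector_norm N.
Variables (J Js E : 'M[R]_n) (mu nu : R).
Hypotheses (Js_unit : Js \in unitmx) (mu_lt1 : mu < 1) (nu_lt1 : nu < 1).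
Hypothesis J_near : forall v, N (invmx Js *m (J - Js) *m v) <= mu * N v.
Hypothesis E_small : forall v, N (invmx J *m E *m v) <= nu * N v.

Lemma near_factor : J = Js *m (1%:M + invmx Js *m (J - Js)).
Proof. by rewrite mulmxDr mulmx1 mulKVmx // addrC subrK. Qed.

Lemma near_unit : J \in unitmx.
Proof.
by rewrite near_factor unitmx_mul Js_unit (unitmx_contraction N_norm mu_lt1).
Qed.

Lemma backward_factor : J + E = J *m (1%:M + invmx J *m E).
Proof. by rewrite mulmxDr mulmx1 mulKVmx // near_unit. Qed.

Lemma backward_unit : J + E \in unitmx.
Proof.
by rewrite backward_factor unitmx_mul near_unit (unitmx_contraction N_norm nu_lt1).
Qed.

(** The estimate is purely linear: [d] is the current error and [e] the error
made on the residual [2^-1 *: ((J + Js) *m d)]. *)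
Lemma inexact_newton_step (d e : 'cV[R]_n) :
  N (d - invmx (J + E) *m (2^-1 *: ((J + Js) *m d) + e)) <=
  (nu / (1 - nu) + mu / (2 * (1 - mu) * (1 - nu))) * N d
  + 1 / (1 - nu) * (1 / (1 - mu)) * N (invmx Js *m e).
Proof.
set r := 2^-1 *: _; set y := d - _.
pose T1 := invmx Js *m (J - Js); pose T2 := invmx J *m E.
pose s := 2^-1 *: ((Js - J) *m d) + e; pose z := invmx J *m s.
have rE : r + e = J *m d + s.
  rewrite /r /s addrA; congr (_ + e).
  rewrite mulmxDl mulmxBl !scalerDr scalerN.
  by apply/colP => i; rewrite !mxE; field.
have yE : (1%:M + T2) *m y = T2 *m d - z.
  have -> : 1%:M + T2 = invmx J *m (J + E).
    by rewrite backward_factor mulKmx // near_unit.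
  rewrite -mulmxA mulmxBr mulKVmx ?backward_unit // rE mulmxDl opprD addrACA.
  by rewrite subrr add0r mulmxBr mulmxA.
have zE : (1%:M + T1) *m z = invmx Js *m e - 2^-1 *: (T1 *m d).
  have -> : 1%:M + T1 = invmx Js *m J by rewrite near_factor mulKmx.
  rewrite -mulmxA mulKVmx ?near_unit // mulmxDr addrC; congr (_ + _).
  by rewrite -scalemxAr -scalerN -mulmxA -mulmxN -mulNmx opprB.
have z_le : (1 - mu) * N z <= N (invmx Js *m e) + 2^-1 * (mu * N d).
  apply: (le_trans (contraction_lower_bound N_norm J_near z)); rewrite zE.
  apply: (le_trans (vector_normB N_norm _ _)); rewrite lerD2l.
  by rewrite (vector_normZ N_norm) ger0_norm ?invr_ge0 // ler_wpM2l ?invr_ge0.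
have y_le : (1 - nu) * N y <= nu * N d + N z.
  apply: (le_trans (contraction_lower_bound N_norm E_small y)); rewrite yE.
  by apply: (le_trans (vector_normB N_norm _ _)); rewrite lerD2r.
have mu1 : 0 < 1 - mu by rewrite subr_gt0.
have nu1 : 0 < 1 - nu by rewrite subr_gt0.
rewrite -(ler_pdivlMl _ _ mu1) in z_le.
rewrite -(ler_pdivlMl _ _ nu1) in y_le.
apply: (le_trans y_le).
have -> : (nu / (1 - nu) + mu / (2 * (1 - mu) * (1 - nu))) * N d
  + 1 / (1 - nu) * (1 / (1 - mu)) * N (invmx Js *m e) =
  (1 - nu)^-1 * (nu * N d +
     (1 - mu)^-1 * (N (invmx Js *m e) + 2^-1 * (mu * N d))).
  by field; rewrite !gt_eqF.
by rewrite ler_pM2l ?invr_gt0 // lerD2l.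
Qed.

End NewtonStep.

(** * Newton's method in floating-point arithmetic *)

Theorem theorem6p1 (R : realType) (n : nat) (N : 'cV[R]_n -> R)
    (a : 'cV[R]_n) (B : 'I_n -> 'I_n -> 'I_n -> R) (xs : 'cV[R]_n)
    (u beta nu mu : R) (xt rt h e : nat -> 'cV[R]_n) (E : nat -> 'M[R]_n)
    (eps : nat -> 'cV[R]_n)
    (N_norm : vector_norm N) (N_mono : monotone_norm N)
    (a_ge0 : forall i, 0 <= a i 0) (B_ge0 : forall i j k, 0 <= B i j k)
    (xs_sol : xs = a + tensor_sq B xs)
    (xs_reg : jacobian B xs \in unitmx)
    (u_ge0 : 0 <= u)
    (newton : machine_newton a B u xt rt h e E eps)
    (beta_lip : jacobian_lipschitz B N beta)
    (nu_lt1 : nu < 1) (mu_lt1 : mu < 1)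
    (k : nat)
    (E_le : induced_norm N (invmx (jacobian B (xt k)) *m E k) <= nu)
    (xt_le : beta * induced_norm N (invmx (jacobian B xs)) * N (xt k - xs)
             <= mu) :
  let G := nu / (1 - nu) + mu / (2 * (1 - mu) * (1 - nu)) + u in
  let g := 1 / (1 - nu) * (1 / (1 - mu)) * N (invmx (jacobian B xs) *m e k)
           + u * (N xs + N (h k)) in
  N (xt k.+1 - xs) <= G * N (xt k - xs) + g.
Proof.
cbv zeta.
set J := jacobian B (xt k); set Js := jacobian B xs; set d := xt k - xs.
(* Two induced-norm bounds in a row: [invmx Js] after [J - Js], the latter
   controlled by the Lipschitz constant. *)
have J_near v : N (invmx Js *m (J - Js) *m v) <= mu * N v.
  rewrite -mulmxA; apply: (le_trans (induced_normP N_norm N_mono _ _)).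
  apply: (@le_trans _ _ (induced_norm N (invmx Js) * (beta * N d * N v))).
    apply: ler_wpM2l; first exact: induced_norm_ge0.
    apply: (le_trans (induced_normP N_norm N_mono _ _)).
    by apply: ler_wpM2r; [exact: vector_norm_ge0 | exact: beta_lip].
  rewrite !mulrA [_ * beta]mulrC.
  by apply: ler_wpM2r; first exact: vector_norm_ge0.
have E_small v : N (invmx J *m E k *m v) <= nu * N v.
  apply: (le_trans (induced_normP N_norm N_mono _ _)).
  by apply: ler_wpM2r; first exact: vector_norm_ge0.
have residual_xs : residual a B xs = 0.
  by rewrite /residual {1}xs_sol addrAC addrK subrr.
have hE : h k = invmx (J + E k) *m (2^-1 *: ((J + Js) *m d) + e k).
  rewrite (newton_increment newton) -(residualB B a).
  by rewrite residual_xs subr0.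
have step_le :=
  inexact_newton_step N_norm xs_reg mu_lt1 nu_lt1 J_near E_small d (e k).
rewrite -hE in step_le.
have round_le : N (xt k.+1 - (xt k - h k)) <= u * N (xt k - h k).
  apply: rounding_error_le => // i.
  have [delta delta_le xtE] := newton_fl_sub newton k i.
  by exists delta; rewrite // xtE !mxE.
have size_le : N (xt k - h k) <= N d + N xs + N (h k).
  apply: (le_trans (vector_normB N_norm _ _)); rewrite lerD2r.
  by rewrite -{1}(subrK xs (xt k)); apply: (vector_normD N_norm).
have -> : xt k.+1 - xs = (xt k.+1 - (xt k - h k)) + (d - h k).
  by apply/colP => i; rewrite !mxE; ring.
apply: (le_trans (vector_normD N_norm _ _)).
by have := ler_wpM2l u_ge0 size_le; lra.
Qed.
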